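(* Define integers $c_X(m)$ and $c_\chi(m)$ by \[ \sum_{m=0}^{\infty}c_X(m)q^m=X(q):=\sum_{n=0}^{\infty}\frac{(-1)^nq^{n^2}}{(-q;q)_{2n}},\qquad \sum_{m=0}^{\infty}c_\chi(m)q^m=\chi(q):=\sum_{n=0}^{\infty}\frac{(-1)^nq^{(n+1)^2}}{(-q;q)_{2n+1}}. \] Then for every $k\in\mathbb{N}$, \[ \sum_{n=0}^{k}\big(b(n)c_X(k-n)+b_1(n)c_\chi(k-n)\big)\equiv0\pmod 2, \] where $b(n)$ is the number of non-Rascoe partitions of $n$ and $b_1(n)$ is the number of generalized non-Rascoe partitions of $n$ associated with $\ell=1$.
   Context: A non-Rascoe partition of $n$ is a partition of $n$ into distinct parts such that the number of parts is not a part; a generalized non-Rascoe partition associated with $\ell=1$ is a partition into distinct parts such that (number of parts) $+1$ is not a part. In both cases the empty partition counts, so $b(0)=b_1(0)=1$. Notation: $(a;q)_n=\prod_{k=0}^{n-1}(1-aq^k)$, $(a;q)_0=1$. *)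

(* Defs.v *)
From HB Require Import structures.
From mathcomp Require Import all_boot all_order all_algebra.
Set Implicit Arguments.
Unset Strict Implicit.
Unset Printing Implicit Defensive.
Import GRing.Theory.
Local Open Scope ring_scope.

(* (a; q)_n, in any commutative ring *)
Definition qpoch (R : comNzRingType) (a q : R) (n : nat) : R :=
  \prod_(k < n) (1 - a * q ^+ k).

(* A formal power series in q over the integers is its coefficient sequence
   nat -> int; a polynomial in q is an element of {poly int}, with q := 'X. *)

(* First n coefficients of 1 / d for a polynomial d with d`_0 = 1, obtained by
   solving d * (1 / d) = 1 degree by degree. *)
Fixpoint inv_coefs (d : {poly int}) (n : nat) : seq int :=
  if n is m.+1 then
    let s := inv_coefs d m in
    rcons s ((m == 0)%N%:R - \sum_(i < m) s`_i * d`_(m - i))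
  else [::].

Definition fps_inv (d : {poly int}) (m : nat) : int := (inv_coefs d m.+1)`_m.

(* expansion of the rational function p / d, for d`_0 = 1 *)
Definition fps_div (p d : {poly int}) (m : nat) : int :=
  \sum_(i < m.+1) p`_i * fps_inv d (m - i).

(* s is the sum of the series of power series F 0 + F 1 + ..., in the q-adic
   topology: each coefficient of the partial sums is eventually that of s. *)
Definition fps_sums (F : nat -> nat -> int) (s : nat -> int) : Prop :=
  forall m, exists N, forall M, (N <= M)%N -> \sum_(n < M) F n m = s m.

Definition X_term (n : nat) : nat -> int :=
  fps_div ((-1) ^+ n * 'X^(n ^ 2)%N) (qpoch (- 'X) 'X (2 * n)%N).

Definition chi_term (n : nat) : nat -> int :=
  fps_div ((-1) ^+ n * 'X^(n.+1 ^ 2)%N) (qpoch (- 'X) 'X (2 * n).+1%N).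

(* Partitions of n into distinct parts are the sets of positive integers with
   sum n; all the parts are at most n, so they are sets in 'I_n.+1. *)
Definition distinct_partition (n : nat) (A : {set 'I_n.+1}) : bool :=
  (ord0 \notin A) && (\sum_(i in A) i == n)%N.

(* #|A| is the number of parts; l = 0 gives the non-Rascoe partitions. *)
Definition non_rascoe (l n : nat) (A : {set 'I_n.+1}) : bool :=
  distinct_partition A && [forall i in A, (i : nat) != (#|A| + l)%N].

Definition b (n : nat) : nat := #|[set A : {set 'I_n.+1} | non_rascoe 0 A]|.
Definition b1 (n : nat) : nat := #|[set A : {set 'I_n.+1} | non_rascoe 1 A]|.

Lemma size_inv_coefs d n : size (inv_coefs d n) = n.
Proof. by elim: n => //= n IH; rewrite size_rcons IH. Qed.

Lemma nth_inv_coefs d n i : (i < n)%N -> (inv_coefs d n)`_i = fps_inv d i.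
Proof.
elim: n => // n IH; rewrite ltnS leq_eqVlt => /orP[/eqP -> //|lt_in] /=.
by rewrite nth_rcons size_inv_coefs lt_in IH.
Qed.

Lemma fps_mulV (d : {poly int}) m : d`_0 = 1 ->
  \sum_(i < m.+1) fps_inv d i * d`_(m - i) = (m == 0)%N%:R.
Proof.
move=> d0; rewrite big_ord_recr /= subnn d0 mulr1.
rewrite {2}/fps_inv /= nth_rcons size_inv_coefs ltnn eqxx.
rewrite (eq_bigr (fun i : 'I_m => (inv_coefs d m)`_i * d`_(m - i))).
  by rewrite addrC subrK.
by move=> i _; rewrite nth_inv_coefs.
Qed.

Lemma coef0_qpoch n : (qpoch (- 'X : {poly int}) 'X n)`_0 = 1.
Proof.
rewrite /qpoch; elim: n => [|n IH]; first by rewrite big_ord0 coef1.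
rewrite big_ord_recr /= coef0M IH mul1r coefB coef1 mulNr coefN -exprS coefXn.
by rewrite /= oppr0 subr0.
Qed.

Lemma fps_sums_lower F : (forall n m, (m < n)%N -> F n m = 0) ->
  fps_sums F (fun m => \sum_(n < m.+1) F n m).
Proof.
move=> F0 m; exists m.+1 => M le_mM.
rewrite -!(big_mkord xpredT (F^~ m)) (big_cat_nat (leq0n m.+1) le_mM) //=.
rewrite [X in _ + X]big_nat_cond [X in _ + X]big1 ?addr0 // => n.
by rewrite andbT => /andP[lt_mn _]; apply: F0.
Qed.

Lemma fps_div_sgnXn0 n e d m : (m < e)%N ->
  fps_div ((-1) ^+ n * 'X^e) d m = 0.
Proof.
move=> lt_me; apply: big1 => i _.
rewrite coefMXn (leq_ltn_trans _ lt_me) ?mul0r //.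
by rewrite -ltnS.
Qed.

Lemma X_exists : exists cX, fps_sums X_term cX.
Proof.
eexists; apply: fps_sums_lower => n m lt_mn; apply: fps_div_sgnXn0.
by apply: leq_trans lt_mn _; rewrite expnS expn1; case: n => // n; apply: leq_pmulr.
Qed.

Lemma chi_exists : exists cchi, fps_sums chi_term cchi.
Proof.
eexists; apply: fps_sums_lower => n m lt_mn; apply: fps_div_sgnXn0.
apply: leq_trans lt_mn _; apply: leq_trans (leqnSn n) _.
by rewrite expnS expn1 leq_pmulr.
Qed.

Lemma fps_sums_unique F s t : fps_sums F s -> fps_sums F t -> s =1 t.
Proof.
move=> Fs Ft m; have [N HN] := Fs m; have [P HP] := Ft m.
by rewrite -(HN (maxn N P)) ?leq_maxl // HP ?leq_maxr.
Qed.

(* Main.v *)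
(* Everything happens modulo 2 and modulo q^(k+1), where 1/(-q;q)_n becomes
   1/(q;q)_n. For every integer l put
     X_l = sum over n = l mod 2 of q^(((n - l)/2)^2) / (q;q)_n.
   Then X_0 = X, X_(-1) = chi, and 1/(q;q)_n = 1/(q;q)_(n-1) + q^n/(q;q)_n
   gives X_(l+1) = X_l + q^l X_(l-1).
   Inclusion-exclusion shows that the generating function B_l of the partitions
   into distinct parts in which (number of parts) + l is not a part is, modulo 2,
   (q;q)_oo G_l with G_l = sum of q^(n^2 + l n) / (q;q)_n, and these satisfy the
   dual recurrence G_l = G_(l+1) + q^(l+1) G_(l+2). Hence the Casoratian
   B_l X_l + q^l B_(l+1) X_(l-1) does not depend on l. It is B X + B_1 chi at
   l = 0. As l grows, B_l tends to (q;q)_oo and X_l tends to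
   (1/(q;q)_oo) * (sum of q^(s^2) over all integers s), where the terms s and -s
   cancel modulo 2; so the constant value is 1. *)
From HB Require Import structures.
Require Import Defs.
From mathcomp Require Import all_boot all_order all_algebra.
From mathcomp Require Import zify ring.
Set Implicit Arguments.
Unset Strict Implicit.
Unset Printing Implicit Defensive.
Import GRing.Theory.
Local Open Scope ring_scope.

(** * Inverses of q-Pochhammer symbols for nilpotent q *)

Section Nilpotent.
Variables (R : comNzRingType) (q : R) (k : nat).
Hypothesis qk0 : q ^+ k.+1 = 0.

Lemma nilp_exp n : (k < n)%N -> q ^+ n = 0.
Proof. by move=> /subnK <-; rewrite exprD qk0 mulr0. Qed.

(** The geometric series of 1/(1 - q^n) for n > 0, cut where [qk0] kills all further terms. *)
Definition geom n : R := \sum_(j < k.+1) q ^+ (n * j).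

Lemma mul_geom n : (0 < n)%N -> (1 - q ^+ n) * geom n = 1.
Proof.
move=> n0; rewrite /geom (eq_bigr (fun j : 'I_k.+1 => (q ^+ n) ^+ j)) => [|j _].
  apply: oppr_inj; rewrite -mulNr opprB -subrX1 -exprM nilp_exp ?sub0r //.
  exact: leq_pmull.
by rewrite exprM.
Qed.

Definition invpoch n : R := \prod_(i < n) geom i.+1.

Lemma invpochS n : invpoch n.+1 = invpoch n + q ^+ n.+1 * invpoch n.+1.
Proof.
rewrite [X in X + _](_ : _ = (1 - q ^+ n.+1) * invpoch n.+1); first by ring.
by rewrite /invpoch big_ord_recr /= mulrCA mul_geom ?mulr1.
Qed.

Lemma invpochK n : qpoch q q n * invpoch n = 1.
Proof. by rewrite -big_split big1 //= => i _; rewrite -exprS mul_geom. Qed.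

Lemma qpoch_stable n : (k <= n)%N -> qpoch q q n = qpoch q q k.
Proof.
move=> /subnK <-; elim: (n - k)%N => // m IH.
rewrite addSn /qpoch big_ord_recr /= -exprS nilp_exp ?subr0 ?mulr1 //.
by rewrite ltnS leq_addl.
Qed.

Lemma invpoch_stable n : (k <= n)%N -> invpoch n = invpoch k.
Proof.
move=> /subnK <-; elim: (n - k)%N => // m IH.
by rewrite addSn invpochS nilp_exp ?mul0r ?addr0 // ltnS leq_addl.
Qed.

(** * The sums G_l and their recurrence *)

Definition rr_sum l : R := \sum_(i < k.+1) q ^+ (i ^ 2 + l * i) * invpoch i.

(** [invpochS] splits summand i + 1 of G_l into summand i + 1 of G_(l+1) and summand i of q^(l+1)
    G_(l+2). *)
Lemma rr_sum_rec l : rr_sum l = rr_sum l.+1 + q ^+ l.+1 * rr_sum l.+2.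
Proof.
rewrite {1 2}/rr_sum !big_ord_recl /= -addrA; congr (_ + _).
rewrite /rr_sum big_ord_recr /= mulrDr mulrA -exprD.
(* The unmatched summand i = k of q^(l+1) G_(l+2) has exponent above k. *)
rewrite [X in _ + (_ + X * _)]nilp_exp; last by lia.
rewrite mul0r addr0 mulr_sumr -big_split /=; apply: eq_bigr => i _.
rewrite /bump add1n {1}invpochS mulrDr !mulrA -!exprD addrC.
by congr (q ^+ _ * _ + q ^+ _ * _); nia.
Qed.

Lemma rr_sum_lim l : (k <= l)%N -> rr_sum l = 1.
Proof.
move=> le_kl; rewrite /rr_sum big_ord_recl /= muln0 mul1r /invpoch big_ord0.
by rewrite big1 ?addr0 // => i _; rewrite nilp_exp ?mul0r //= /bump; nia.
Qed.

(** * The series X_l and their recurrence *)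

(* The numerator of the summand of X_l; one of the truncated differences is 0. *)
Definition sqd n l : R :=
  if odd (n + l) then 0 else q ^+ (((n - l) + (l - n))./2 ^ 2).

Lemma sqdSS n l : sqd n.+1 l.+1 = sqd n l.
Proof. by rewrite /sqd addSn addnS /= negbK !subSS. Qed.

(** (n + 1 - l)/2 and (n - 1 - l)/2 are consecutive with sum n - l, so their squares differ by n -
    l. *)
Lemma sqd_shift n l : q ^+ n * sqd n l.+1 = q ^+ l * sqd n.+1 l.
Proof.
rewrite /sqd addSn addnS; case: ifP => [|/negbT]; first by rewrite !mulr0.
rewrite /= negbK => odd_nl; rewrite -!exprD; congr (q ^+ _).
have := odd_double_half (n + l); rewrite odd_nl; set m := (n + l)./2 => e.
have [le_nl|lt_ln] := leqP n l.
  rewrite (_ : n - l.+1 + _ = (m - n).+1.*2)%N; last by lia.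
  rewrite (_ : n.+1 - l + _ = (m - n).*2)%N; last by lia.
  by rewrite !doubleK; nia.
rewrite (_ : n - l.+1 + _ = (m - l).*2)%N; last by lia.
rewrite (_ : n.+1 - l + _ = (m - l).+1.*2)%N; last by lia.
by rewrite !doubleK; nia.
Qed.

Lemma sqd_far n l : (n + k.*2 < l)%N || (l + k.*2 < n)%N -> sqd n l = 0.
Proof.
move=> far; rewrite /sqd; case: ifP => // /negbT; rewrite -dvdn2 => even_nl.
by apply: nilp_exp; set m := (_./2); have : (k < m)%N by [lia]; nia.
Qed.

(* X_(l - 1), cut after L terms: the shift keeps l = -1 within nat. *)
Definition qsum L l : R := \sum_(n < L) sqd n.+1 l * invpoch n.

(** [invpochS] splits the summands of [qsum L l.+2]: one half gives [qsum L l.+1], the other becomes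
    [q ^+ l * qsum L l] by [sqd_shift]. *)
Lemma qsum_rec L l : ((l + k.*2).+1 < L)%N ->
  qsum L l.+2 = qsum L l.+1 + q ^+ l * qsum L l.
Proof.
(* The bound on [L] makes the last summand vanish by [sqd_far]. *)
move=> lt_lL; have -> : qsum L l.+1 = \sum_(n < L.-1) sqd n.+1 l.+1 * invpoch n.
  case: L lt_lL => [|L] lt_lL; first by rewrite /qsum big_ord0.
  by rewrite /qsum big_ord_recr /= sqdSS sqd_far ?mul0r ?addr0 // [X in _ || X]lt_lL orbT.
case: L lt_lL => [//|L] _ /=.
have -> : q ^+ l * qsum L.+1 l = \sum_(n < L.+1) q ^+ n * sqd n l.+1 * invpoch n.
  by rewrite mulr_sumr; apply: eq_bigr => n _; rewrite mulrA sqd_shift.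
rewrite /qsum !big_ord_recl /= addrCA sqdSS expr0 mul1r; congr (_ + _).
rewrite -big_split; apply: eq_bigr => n _ /=.
by rewrite /bump add1n sqdSS {1}invpochS; ring.
Qed.

(** * Invariance and value of the Casoratian *)

Lemma casoratian_step L l : ((l + k.*2).+1 < L)%N ->
  rr_sum l * qsum L l.+1 + q ^+ l * (rr_sum l.+1 * qsum L l) =
  rr_sum l.+1 * qsum L l.+2 + q ^+ l.+1 * (rr_sum l.+2 * qsum L l.+1).
Proof. by move=> lt_lL; rewrite qsum_rec // (rr_sum_rec l); ring. Qed.

Hypothesis char2 : 2%N \in [pchar R].

(* The terms n and 2 l - n cancel, which leaves n = l. *)
Lemma sum_sqd l : \sum_(n < l.*2.+1) sqd n l = 1.
Proof.
rewrite -(big_mkord xpredT (sqd^~ l)) (big_cat_nat (n := l)) //=; last by lia.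
rewrite [X in _ + X]big_nat_recl; last by lia.
rewrite {2}/sqd addnn odd_double subnn expr0 addrCA.
rewrite big_nat_rev /= [X in _ + (X + _)](_ : _ = \sum_(l <= i < l.*2) sqd i.+1 l).
  by rewrite (addrr_pchar2 char2) ?addr0.
rewrite -[RHS]/(\sum_(0 + l <= i < l.*2) sqd i.+1 l) big_addn.
rewrite (_ : l.*2 - l = l)%N; last by lia.
apply: eq_big_nat => i /andP[_ lt_il]; rewrite /sqd add0n.
rewrite (_ : odd (l - i.+1 + l) = odd ((i + l).+1 + l)); last by lia.
by congr (if _ then _ else q ^+ (_./2 ^ 2)); lia.
Qed.

(* L must exceed l + 2 k + 1 for l <= 3 k, and at l = 3 k + 1 only the terms with
   n >= k survive, where 1/(q;q)_n is already 1/(q;q)_oo. *)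
Lemma casoratian (L := (3 * k).+1.*2.+1) :
  rr_sum 0 * qsum L 1 + rr_sum 1 * qsum L 0 = invpoch k.
Proof.
pose W l := rr_sum l * qsum L l.+1 + q ^+ l * (rr_sum l.+1 * qsum L l).
have W_const l : (l <= (3 * k).+1)%N -> W l = W 0%N.
  elim: l => // l IH lt_l; rewrite -IH ?(ltnW lt_l) //.
  by rewrite /W [in RHS]casoratian_step // /L; lia.
have <- : W 0%N = rr_sum 0 * qsum L 1 + rr_sum 1 * qsum L 0 by rewrite /W mul1r.
rewrite -(W_const (3 * k).+1) // /W nilp_exp; last by lia.
rewrite mul0r addr0 rr_sum_lim ?mul1r; last by lia.
rewrite -[RHS]mul1r -(sum_sqd (3 * k).+1) mulr_suml.
apply: eq_bigr => n _; rewrite sqdSS.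
have [le_kn|lt_nk] := leqP k n; first by rewrite invpoch_stable.
by rewrite sqd_far ?mul0r //; lia.
Qed.

Lemma oppr_char2 (x : R) : - x = x.
Proof. exact: oppr_pchar2. Qed.

(** In characteristic 2 the product is (q;q)_(i+M) / (q;q)_i, and the numerator is already
    stable. *)
Lemma euler_prod_tail M i : (k <= M)%N ->
  \prod_(j < M) (1 + q ^+ (i + j.+1)) = qpoch q q k * invpoch i.
Proof.
move=> le_kM; rewrite -(@qpoch_stable (i + M)) ?(leq_trans le_kM) ?leq_addl //.
rewrite /qpoch big_split_ord /= mulrAC -/(qpoch q q i) invpochK mul1r.
by apply: eq_bigr => j _; rewrite -exprS oppr_char2 addnS.
Qed.

Lemma sum_triangle (V : nmodType) (F : nat -> nat -> V) D :
  \sum_(n < D) \sum_(i < n.+1) F i (n - i)%N =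
  \sum_(i < D) \sum_(m < D - i) F i m.
Proof.
elim: D => [|D IH]; first by rewrite !big_ord0.
rewrite big_ord_recr IH [in RHS]big_ord_recr /= subSnn big_ord1.
rewrite big_ord_recr /= subnn addrA -big_split /=; congr (_ + _).
by apply: eq_bigr => i _; rewrite subSn ?big_ord_recr //; apply/ltnW.
Qed.

(** * Distinct parts avoiding a given part, by inclusion-exclusion *)

Section PartSets.
Variable M : nat.
Hypothesis le_kM : (k <= M)%N.
Implicit Type A : {set 'I_M.+1}.

Definition avoid c A := [forall i in A, (i : nat) != c].

(** The elementary symmetric polynomial e_N in q, ..., q^M. *)
Definition esum N : R :=
  \sum_(A : {set 'I_M.+1} | (ord0 \notin A) && (#|A| == N)) q ^+ (\sum_(i in A) i).

Definition avoid_sum N c : R :=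
  \sum_(A : {set 'I_M.+1} | [&& ord0 \notin A, #|A| == N & avoid c A])
     q ^+ (\sum_(i in A) i).

Lemma avoid_sum0 c : avoid_sum 0 c = esum 0.
Proof.
apply: eq_bigl => A; rewrite cards_eq0; case: eqP => [->|]; last by rewrite !andbF.
by congr (_ && (_ && _)); apply/forall_inP => i; rewrite inE.
Qed.

(** A set containing c is c joined to a set avoiding c. If c > M there is none, and q^c = 0. *)
Lemma esumS N c : (0 < c)%N ->
  esum N.+1 = avoid_sum N.+1 c + q ^+ c * avoid_sum N c.
Proof.
move=> c0; rewrite /esum (bigID (avoid c)) /=; congr (_ + _).
  by apply: eq_bigl => A; rewrite andbA.
have [le_cM|lt_Mc] := leqP c M; last first.
  rewrite nilp_exp ?mul0r ?(leq_ltn_trans le_kM) // big1 // => A /andP[_ /negP[]].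
  apply/forall_inP => i _; have := ltn_ord i; lia.
have avoidE A : avoid c A = (inord c \notin A).
  apply/forall_inP/idP => [HA|cA i iA].
    by apply/negP => /HA; rewrite inordK ?eqxx.
  by apply: contra cA => /eqP <-; rewrite inord_val.
have c_neq0 : inord c != ord0 :> 'I_M.+1 by rewrite -val_eqE /= inordK // -lt0n.
rewrite (reindex_onto (setU [set inord c]) (fun A => A :\ inord c)) /=; last first.
  by move=> A /andP[_]; rewrite avoidE negbK => /setD1K.
rewrite mulr_sumr; apply: eq_big => [A|A /andP[_ /eqP HA]]; last first.
  rewrite big_setU1 /= ?inordK // ?exprD //.
  by rewrite -HA setD11.
rewrite !avoidE in_setU1 setU11 andbT eq_sym (negPf c_neq0) /=.
have [cA|cA] := boolP (inord c \in A); last first.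
  by rewrite cardsU1 cA setU1K // eqxx eqSS andbA.
rewrite !andbF; apply/andP => -[_ /eqP HA].
by move: cA; rewrite -HA setD11.
Qed.

(** Iterates [esumS]; the alternating signs vanish in characteristic 2. The case N = c = 0 is the
    empty partition with l = 0. *)
Lemma avoid_sumE N c : (N == 0)%N || (0 < c)%N ->
  avoid_sum N c = \sum_(i < N.+1) esum (N - i)%N * q ^+ (c * i).
Proof.
case: N => [_|N /= c0]; first by rewrite avoid_sum0 big_ord1 muln0 mulr1.
elim: N => [|N IH].
  have := esumS 0 c0; rewrite avoid_sum0 big_ord_recl big_ord1 /= muln0 mulr1 subn0.
  move=> ->; rewrite mulrC muln1 -addrA (addrr_pchar2 char2) ?addr0 //.
rewrite big_ord_recl muln0 mulr1 subn0 (esumS N.+1 c0) IH mulr_sumr -addrA.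
rewrite -big_split big1 /= ?addr0 // => i _.
rewrite /bump add1n subSS mulnS exprD [X in _ + X]mulrCA (addrr_pchar2 char2) //.
Qed.

Lemma esum_gf i :
  \sum_(m < M.+2) esum m * q ^+ (m * i) = \prod_(j < M) (1 + q ^+ (i + j.+1)).
Proof.
(* The value 0 at [ord0] removes the sets containing [ord0] from the expanded product. *)
pose F (j : 'I_M.+1) : R := if j == ord0 then 0 else q ^+ (i + j).
transitivity (\prod_j (F j + 1)); last first.
  rewrite big_ord_recl {1}/F eqxx add0r mul1r.
  by apply: eq_bigr => j _; rewrite addrC.
rewrite bigA_distr /=.
rewrite (bigID (fun A : {set _} => ord0 \in A)) /=.
rewrite [X in _ = X + _]big1 ?add0r; last first.
  by move=> A A0; rewrite (bigD1 ord0) //= A0 /F eqxx mul0r.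
have card_lt A : (#|A| < M.+2)%N by rewrite ltnS (leq_trans (max_card _)) ?card_ord.
rewrite (partition_big (fun A => Ordinal (card_lt A)) xpredT) //=.
apply: eq_bigr => m _; rewrite mulr_suml; apply: eq_big => [A|A].
  by rewrite -val_eqE.
move=> /andP[A0 /eqP <-]; rewrite -exprD -sum_nat_const -big_split /= -big_mkcond /=.
rewrite (big_morph _ (exprD q) (expr0 q)); apply: eq_bigr => j jA.
by rewrite /F addnC; case: eqP => // j0; rewrite j0 (negPf A0) in jA.
Qed.

(** Sort by the number n of parts, apply [avoid_sumE] with c = n + l, and put n = m + i; for fixed
    i, [esum_gf] evaluates the sum over m. *)
Lemma partition_sum (l : nat) :
  \sum_(A : {set 'I_M.+1} | (ord0 \notin A) && avoid (#|A| + l)%N A)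
     q ^+ (\sum_(i in A) i) = qpoch q q k * rr_sum l.
Proof.
have card_lt A : (#|A| < M.+2)%N by rewrite ltnS (leq_trans (max_card _)) ?card_ord.
rewrite (partition_big (fun A => Ordinal (card_lt A)) xpredT) //=.
transitivity (\sum_(n < M.+2) avoid_sum n (n + l)%N).
  apply: eq_bigr => n _; apply: eq_bigl => A; rewrite -val_eqE /= -andbA.
  by congr (_ && _); rewrite andbC; apply/andb_id2l => /eqP ->.
pose F i m := esum m * q ^+ ((m + i + l) * i).
transitivity (\sum_(n < M.+2) \sum_(i < n.+1) F i (n - i)%N).
  apply: eq_bigr => n _; rewrite avoid_sumE; last by lia.
  by apply: eq_bigr => i _; rewrite /F subnK // -ltnS.
rewrite sum_triangle.
(* The added pairs have i > 0 and m + i > M + 1, so their powers of q vanish. *)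
transitivity (\sum_(i < M.+2) \sum_(m < M.+2) F i m).
  apply: eq_bigr => i _.
  rewrite (big_ord_widen _ (F i) (leq_subr i M.+2)) big_mkcond.
  apply: eq_bigr => m _; case: ifPn => // ge_m.
  have lt_m := ltn_ord m; rewrite /F nilp_exp ?mulr0 //.
  by apply: leq_trans (leq_pmulr _ _); lia.
rewrite /rr_sum mulr_sumr.
pose G i := qpoch q q k * (q ^+ (i ^ 2 + l * i) * invpoch i).
rewrite (big_ord_widen M.+2 G) {}/G; last by lia.
rewrite [RHS]big_mkcond; apply: eq_bigr => i _ /=.
case: ifPn => [_|lt_ki].
  rewrite mulrCA -(euler_prod_tail i le_kM) -esum_gf mulr_sumr.
  by apply: eq_bigr => m _; rewrite /F mulrCA -exprD; congr (_ * q ^+ _); ring.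
rewrite big1 // => m _; rewrite /F nilp_exp ?mulr0 //.
by apply: leq_trans (leq_pmulr _ _); lia.
Qed.
End PartSets.

(** * The parity split that recovers X and chi *)

Lemma qsum1 m : qsum m.*2.+1 1 = \sum_(i < m.+1) q ^+ (i ^ 2) * invpoch (2 * i).
Proof.
rewrite /qsum; elim: m => [|m IH]; first by rewrite !big_ord1.
rewrite doubleS 2!big_ord_recr [in RHS]big_ord_recr IH /= -addrA; congr (_ + _).
rewrite !sqdSS {1}/sqd addn0 /= odd_double mul0r add0r /sqd addn0 /= odd_double.
by rewrite doubleK mul2n doubleS.
Qed.

Lemma qsum0 m : qsum m.*2.+1 0 = \sum_(i < m) q ^+ (i.+1 ^ 2) * invpoch (2 * i).+1.
Proof.
rewrite /qsum; elim: m => [|m IH].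
  by rewrite big_ord1 big_ord0 /sqd /= mul0r.
rewrite doubleS 2!big_ord_recr [in RHS]big_ord_recr IH /= -addrA; congr (_ + _).
rewrite {2}/sqd addn0 /= odd_double mul0r addr0 /sqd addn0 /= odd_double.
by rewrite doubleK mul2n.
Qed.

End Nilpotent.

Lemma rmorph_qpoch (R S : comNzRingType) (f : {rmorphism R -> S}) (a q : R) n :
  f (qpoch a q n) = qpoch (f a) (f q) n.
Proof.
rewrite rmorph_prod; apply: eq_bigr => i _.
by rewrite rmorphB rmorph1 rmorphM rmorphXn.
Qed.

(** * Integer power series modulo 2 and q^(k+1) *)

Section Truncation.
Variable k : nat.

Definition trunc : {poly 'F_2} -> {poly %/ ('X^(k.+1) : {poly 'F_2})} :=
  in_qpoly 'X^(k.+1).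
HB.instance Definition _ := GRing.RMorphism.on trunc.

Local Notation q := (trunc 'X).

Lemma trunc_nilp : q ^+ k.+1 = 0.
Proof.
rewrite -rmorphXn; apply: val_inj => /=.
by rewrite mk_monic_Xn Pdiv.RingMonic.rmodpp ?monicXn.
Qed.

Lemma trunc_char2 : 2%N \in [pchar {poly %/ ('X^(k.+1) : {poly 'F_2})}].
Proof. by rewrite pchar_qpoly pchar_Fp. Qed.

Lemma trunc_take p : trunc p = trunc (take_poly k.+1 p).
Proof.
by rewrite -{1}(poly_take_drop k.+1 p) rmorphD rmorphM rmorphXn /= trunc_nilp mulr0 addr0.
Qed.

Lemma trunc_eqP (p p' : {poly 'F_2}) :
  trunc p = trunc p' <-> forall m, (m <= k)%N -> p`_m = p'`_m.
Proof.
split=> [|eq_pp']; last first.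
  rewrite trunc_take [RHS]trunc_take; congr trunc; apply/polyP => m.
  by rewrite !coef_take_poly; case: ifP => // /eq_pp'.
rewrite trunc_take [RHS]trunc_take => /(congr1 val) /=.
rewrite !Pdiv.CommonRing.rmodp_small ?mk_monic_Xn ?size_polyXn ?ltnS ?size_take_poly //.
move=> eq_take m le_mk; have := congr1 (coefp m) eq_take.
by rewrite /= !coef_take_poly ltnS le_mk.
Qed.

Definition ser (f : nat -> int) := trunc (\poly_(m < k.+1) (f m)%:~R).

Lemma ser_eqP f g : ser f = ser g <->
  forall m, (m <= k)%N -> (f m)%:~R = (g m)%:~R :> 'F_2.
Proof.
rewrite trunc_eqP; split=> eq_fg m le_mk; have := eq_fg m le_mk;
  by rewrite !coef_poly ltnS le_mk.
Qed.

Lemma ser_trunc f (p : {poly 'F_2}) :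
  (forall m, (m <= k)%N -> (f m)%:~R = p`_m) -> ser f = trunc p.
Proof.
by move=> eq_fp; apply/trunc_eqP => m le_mk; rewrite coef_poly ltnS le_mk eq_fp.
Qed.

Lemma serM f g : ser f * ser g = ser (fun m => \sum_(i < m.+1) f i * g (m - i)%N).
Proof.
symmetry; rewrite -rmorphM; apply: ser_trunc => m le_mk.
rewrite coefM rmorph_sum; apply: eq_bigr => i _.
rewrite !coef_poly rmorphM !ifT // ltnS ?(leq_trans (leq_subr _ _)) //.
by rewrite (leq_trans _ le_mk) // -ltnS.
Qed.

Lemma serD f g : ser f + ser g = ser (fun m => f m + g m).
Proof.
symmetry; rewrite -rmorphD; apply: ser_trunc => m le_mk.
by rewrite coefD !coef_poly ltnS le_mk rmorphD.
Qed.

Lemma ser_sum (F : nat -> nat -> int) N :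
  ser (fun m => \sum_(n < N) F n m) = \sum_(n < N) ser (F n).
Proof.
rewrite -rmorph_sum; apply: ser_trunc => m le_mk.
by rewrite coef_sum rmorph_sum; apply: eq_bigr => n _; rewrite coef_poly ltnS le_mk.
Qed.

Definition red (p : {poly int}) := trunc (map_poly intr p).
HB.instance Definition _ := GRing.RMorphism.copy red
  (trunc \o (map_poly (intr : int -> 'F_2))).

Lemma redX : red 'X = q.
Proof. by rewrite /red map_polyX. Qed.

Lemma red_coef (p : {poly int}) : ser (fun m => p`_m) = red p.
Proof. by apply: ser_trunc => m _; rewrite coef_map. Qed.

(** By [fps_mulV] the series [fps_inv d] is an inverse of [red d], and inverses are unique. *)
Lemma ser_div (p d : {poly int}) v :
  d`_0 = 1 -> red d * v = 1 -> ser (fps_div p d) = red p * v.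
Proof.
move=> d0 dv; have -> : ser (fps_div p d) = red p * ser (fps_inv d).
  by rewrite -red_coef serM.
congr (_ * _); rewrite -[LHS]mulr1 -dv mulrA -red_coef serM -[RHS]mul1r.
congr (_ * _); have <- : red 1 = 1 by exact: rmorph1.
rewrite -red_coef; apply/ser_eqP => m _.
by rewrite fps_mulV // coef1.
Qed.

Lemma red_signX n e : red ((-1) ^+ n * 'X^e) = q ^+ e.
Proof.
rewrite rmorphM !rmorphXn rmorphN rmorph1 /= redX (oppr_char2 trunc_char2).
by rewrite expr1n mul1r.
Qed.

Lemma red_qpoch n : red (qpoch (- 'X) 'X n) = qpoch q q n.
Proof. by rewrite rmorph_qpoch rmorphN /= redX (oppr_char2 trunc_char2). Qed.

Lemma ser_term n e s :
  ser (fps_div ((-1) ^+ s * 'X^e) (qpoch (- 'X) 'X n)) = q ^+ e * invpoch q k n.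
Proof.
rewrite -(red_signX s); apply: ser_div; first exact: coef0_qpoch.
by rewrite red_qpoch; apply: invpochK trunc_nilp n.
Qed.

End Truncation.

(** * Partition counts as coefficients modulo 2 *)

Definition part_poly M l : {poly 'F_2} :=
  \sum_(A : {set 'I_M.+1} | (ord0 \notin A) && avoid (#|A| + l)%N A)
     'X^(\sum_(i in A) i)%N.

Lemma coef_part_poly n l :
  (part_poly n l)`_n = #|[set A : {set 'I_n.+1} | non_rascoe l A]|%:R.
Proof.
rewrite /part_poly coef_sum -sum1_card natr_sum.
rewrite [RHS](eq_bigl _ _ (fun A => in_set _ A)) big_mkcond [RHS]big_mkcond /=.
apply: eq_bigr => A _; rewrite coefXn /non_rascoe /distinct_partition /avoid eq_sym.
by rewrite andbAC; case: ifP => //= _; case: eqP.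
Qed.

Lemma trunc_part_poly k M l : (k <= M)%N ->
  trunc k (part_poly M l) = qpoch (trunc k 'X) (trunc k 'X) k * rr_sum (trunc k 'X) k l.
Proof.
move=> le_kM; rewrite -(partition_sum (trunc_nilp k) (trunc_char2 k) le_kM).
by rewrite rmorph_sum; apply: eq_bigr => A _; rewrite rmorphXn.
Qed.

(* b(m) is the coefficient of q^m in part_poly m l; it is also the one in
   part_poly k l, as both have the same closed form modulo q^(m+1). *)
Lemma ser_non_rascoe k l :
  ser k (fun n => #|[set A : {set 'I_n.+1} | non_rascoe l A]|%:Z) =
  qpoch (trunc k 'X) (trunc k 'X) k * rr_sum (trunc k 'X) k l.
Proof.
rewrite -(trunc_part_poly l (leqnn k)); apply: ser_trunc => m le_mk.
rewrite -[LHS]coef_part_poly.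
by apply/(trunc_eqP m _ _).1 => //; rewrite !trunc_part_poly.
Qed.

(** [F n] starts at q^n or later, so the terms n > k vanish modulo q^(k+1). *)
Lemma ser_fps_sums k N F s : (forall n m, (m < n)%N -> F n m = 0) -> (k < N)%N ->
  fps_sums F s -> ser k s = \sum_(n < N) ser k (F n).
Proof.
move=> F0 lt_kN Fs; rewrite -ser_sum; apply/ser_eqP => m le_mk.
rewrite (fps_sums_unique Fs (fps_sums_lower F0)); congr intr.
rewrite (big_ord_widen N (F^~ m)) ?(leq_ltn_trans le_mk) // big_mkcond.
by apply: eq_bigr => n _; case: ifPn => //; rewrite -leqNgt => /F0.
Qed.

Lemma X_term_low n m : (m < n)%N -> X_term n m = 0.
Proof. by move=> lt_mn; apply: fps_div_sgnXn0; apply: leq_trans lt_mn _; nia. Qed.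

Lemma chi_term_low n m : (m < n)%N -> chi_term n m = 0.
Proof. by move=> lt_mn; apply: fps_div_sgnXn0; apply: leq_trans lt_mn _; nia. Qed.

Theorem theorem5p3 (cX cchi : nat -> int)
    (hX : fps_sums X_term cX) (hchi : fps_sums chi_term cchi)
    (k : nat) (hk : (0 < k)%N) :
  (\sum_(n < k.+1) ((b n)%:Z * cX (k - n)%N + (b1 n)%:Z * cchi (k - n)%N)
     = 0 %[mod 2])%Z.
Proof.
have serX : ser k cX = qsum (trunc k 'X) k (3 * k).+1.*2.+1 1.
  (* The cut of [casoratian] is [m.*2.+1] with [m = (3 * k).+1]; there [qsum1] has [m.+1] terms and
     [qsum0] has [m]. *)
  rewrite (ser_fps_sums (N := (3 * k).+2) X_term_low _ hX); last by lia.
  by rewrite qsum1; apply: eq_bigr => n _; apply: ser_term.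
have serchi : ser k cchi = qsum (trunc k 'X) k (3 * k).+1.*2.+1 0.
  rewrite (ser_fps_sums (N := (3 * k).+1) chi_term_low _ hchi); last by lia.
  by rewrite qsum0; apply: eq_bigr => n _; apply: ser_term.
have : ser k (fun n => (b n)%:Z) * ser k cX + ser k (fun n => (b1 n)%:Z) * ser k cchi
       = ser k (fun m => (1 : {poly int})`_m).
  rewrite red_coef rmorph1 -(invpochK (trunc_nilp k) k).
  rewrite -(casoratian (trunc_nilp k) (trunc_char2 k)) !ser_non_rascoe serX serchi.
  by rewrite mulrDr !mulrA.
rewrite !serM serD => /ser_eqP /(_ k (leqnn k)).
(* As k > 0, the coefficient of q^k in the constant 1 is 0. *)
rewrite -big_split coef1 eqn0Ngt hk /= => /eqP.
rewrite -(dvdz_pcharf (pchar_Fp _)) // => /dvdz_mod0P ->.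
by rewrite mod0z.
Qed.
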